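(* Let $n \ge m \ge 1$ be integers and let $\bm{A} \in \mathbb{R}^{nm \times nm}$ be symmetric positive semidefinite. Let $\bm{W}^\star$ be an optimal solution to the semidefinite relaxation $$\max_{\bm{W} \in \mathcal{S}^{nm}_+} \ \langle \bm{A}, \bm{W} \rangle \quad \text{s.t.} \quad \sum_{i=1}^m \bm{W}^{(i,i)} \preceq \bm{I}_n, \qquad \operatorname{tr}\big( \bm{W}^{(j,j')} \big)= \delta_{j,j'} \ \ \forall j, j' \in \{1,\dots,m\}.$$ Let $\bm{Q} \in \mathbb{R}^{n \times m}$ be the random semi-orthogonal matrix generated by the relax-and-project algorithm from $\bm{W}^\star$ (defined in the context). Then $$\mathbb{E}\left[\operatorname{vec}(\bm{Q})^\top \bm{A} \operatorname{vec}(\bm{Q}) \right] \ \geq \ \frac{2}{\pi m} \langle \bm{A}, \bm{W}^\star \rangle.$$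
   Context: $\mathcal{S}^{d}_+$ is the cone of $d\times d$ real symmetric positive semidefinite matrices, $\preceq$ is the Loewner order, $\langle\cdot,\cdot\rangle$ is the Frobenius inner product, $\delta_{j,j'}$ is the Kronecker delta. $\operatorname{vec}(\bm{X})\in\mathbb{R}^{nm}$ stacks the columns of $\bm{X}\in\mathbb{R}^{n\times m}$. An $nm\times nm$ matrix $\bm{W}$ is viewed as an $m\times m$ array of $n\times n$ blocks, and $\bm{W}^{(i,j)}$ denotes its $(i,j)$ block. Relax-and-project algorithm: given an optimal solution $\bm{W}^\star$ of the relaxation, sample a random matrix $\bm{G}\in\mathbb{R}^{n\times m}$ with $\operatorname{vec}(\bm{G}) \sim \mathcal{N}(\bm{0}_{nm}, \bm{W}^\star)$ (centered Gaussian with covariance $\bm{W}^\star$, possibly degenerate); compute a singular value decomposition $\bm{G}=\bm{U}\bm{\Sigma}\bm{V}^\top$ with $\bm{U}\in\mathbb{R}^{n\times m}$, $\bm{U}^\top\bm{U}=\bm{I}_m$, $\bm{\Sigma}\in\mathbb{R}^{m\times m}$ diagonal with nonnegative entries, and $\bm{V}\in\mathbb{R}^{m\times m}$ orthogonal (chosen measurably in $\bm{G}$); return $\bm{Q}=\bm{U}\bm{V}^\top$, which satisfies $\bm{Q}^\top\bm{Q}=\bm{I}_m$. *)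

(* Defs.v *)
From HB Require Import structures.
From mathcomp Require Import all_boot all_order all_algebra.
From mathcomp Require Import all_classical all_reals all_analysis.

Set Implicit Arguments.
Unset Strict Implicit.
Unset Printing Implicit Defensive.

Import Order.TTheory GRing.Theory Num.Theory.
Import numFieldNormedType.Exports.

Local Open Scope classical_set_scope.
Local Open Scope ring_scope.

Definition psdmx (R : realType) d (M : 'M[R]_d) : Prop :=
  M^T = M /\ forall x : 'cV[R]_d, 0 <= (x^T *m M *m x) 0 0.

Definition loewner (R : realType) d (M N : 'M[R]_d) : Prop := psdmx (N - M).

Definition frobenius (R : realType) p q (M N : 'M[R]_(p, q)) : R :=
  \tr (M^T *m N).

(* [mxvec] lists the entries row by row, so transposing first stacks the
   columns: the entry (i, j) of X is at position j * n + i (see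
   [val_mxvec_index]). Sizes are written m * n to match. *)
Definition vec (R : realType) n m (X : 'M[R]_(n, m)) : 'cV[R]_(m * n) :=
  (mxvec X^T)^T.

Lemma val_mxvec_index n m (j : 'I_m) (i : 'I_n) :
  mxvec_index j i = (j * n + i)%N :> nat.
Proof.
have idx (s1 : seq 'I_m) : j \in s1 ->
    index (j, i) [seq (x1, x2) | x1 <- s1, x2 <- enum 'I_n] =
      (index j s1 * n + i)%N.
  elim: s1 => // a s IHs; rewrite inE /= index_cat size_map size_enum_ord => js.
  have [-> | ja] := eqVneq a j.
    rewrite map_f ?mem_enum // index_map ?index_enum_ord //.
    by move=> ? ? [].
  have /negPf-> : (j, i) \notin [seq (a, x2) | x2 <- enum 'I_n].
    by apply/mapP => -[x _ [/esym/eqP]]; rewrite (negPf ja).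
  by move: js; rewrite (eq_sym j) (negPf ja) => /IHs ->; rewrite mulSn addnA.
have lt_k : (enum_rank (j, i) < size (enum {: 'I_m * 'I_n}))%N.
  by rewrite -cardE ltn_ord.
rewrite /= -(index_uniq (j, i) lt_k (enum_uniq _)).
rewrite nth_enum_rank enumT unlock /= /prod_enum idx ?mem_enum //.
by rewrite index_enum_ord.
Qed.

Definition blockmx (R : realType) n m (W : 'M[R]_(m * n)) (j j' : 'I_m) :
    'M[R]_n :=
  \matrix_(k, l) W (mxvec_index j k) (mxvec_index j' l).

Definition sdp_feasible (R : realType) n m (W : 'M[R]_(m * n)) : Prop :=
  [/\ psdmx W,
      loewner (\sum_(i < m) blockmx W i i) 1%:M &
      forall j j' : 'I_m, \tr (blockmx W j j') = (j == j')%:R].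

Definition sdp_optimal (R : realType) n m (A W : 'M[R]_(m * n)) : Prop :=
  sdp_feasible W /\
  forall W' : 'M[R]_(m * n), sdp_feasible W' -> frobenius A W' <= frobenius A W.

(* Matrices with the Borel sigma-algebra of their usual topology. *)
Notation borelMx R n m := (g_sigma_algebraType (@open 'M[R]_(n, m))).

(* Since B i = setT is allowed, the product rule for all subfamilies follows. *)
Definition mutually_independent (R : realType) (d : measure_display)
    (T : measurableType d) (P : probability T R) k
    (Z : 'I_k -> {RV P >-> R}) : Prop :=
  forall B : 'I_k -> set R, (forall i, measurable (B i)) ->
    P (\bigcap_i (Z i @^-1` B i)) = (\prod_(i < k) P (Z i @^-1` B i))%E.

Definition standard_normal_family (R : realType) (d : measure_display)
    (T : measurableType d) (P : probability T R) k
    (Z : 'I_k -> {RV P >-> R}) : Prop :=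
  mutually_independent Z /\
  forall i (B : set R), measurable B ->
    distribution P (Z i) B = normal_prob 0 1 B.

(* X ~ N(0, S), with S possibly singular: X is a linear image L Z of a standard
   normal vector Z, with L L^T = S. Asking for Z on the same probability space
   loses no generality, as one may take L of full column rank and recover Z
   from X by a left inverse of L. *)
Definition centered_gaussian (R : realType) (d : measure_display)
    (T : measurableType d) (P : probability T R) p
    (X : T -> 'cV[R]_p) (S : 'M[R]_p) : Prop :=
  exists (k : nat) (L : 'M[R]_(p, k)) (Z : 'I_k -> {RV P >-> R}),
    [/\ standard_normal_family Z,
        L *m L^T = S &
        {ae P, forall t, X t = L *m \col_i Z i t}].

Definition is_svd (R : realType) n m (M U : 'M[R]_(n, m)) (D V : 'M[R]_m) :
    Prop :=
  [/\ M = U *m D *m V^T,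
      U^T *m U = 1%:M,
      is_diag_mx D,
      forall i, 0 <= D i i &
      V^T *m V = 1%:M].

(* Q is a random matrix returned by the rounding procedure on input W: the
   singular value decomposition of G is given by Borel functions of G. *)
Definition relax_and_project (R : realType) (d : measure_display)
    (T : measurableType d) (P : probability T R) n m
    (W : 'M[R]_(m * n)) (Q : T -> 'M[R]_(n, m)) : Prop :=
  exists (G : {RV P >-> borelMx R n m})
         (U : {mfun borelMx R n m >-> borelMx R n m})
         (D V : {mfun borelMx R n m >-> borelMx R m m}),
    [/\ centered_gaussian P (fun t => vec (G t)) W,
        forall M : 'M[R]_(n, m), is_svd M (U M) (D M) (V M) &
        forall t, Q t = U (G t) *m (V (G t) : 'M[R]_m)^T].

(* Main.v *)
From HB Require Import structures.
Require Import Defs.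
From mathcomp Require Import all_boot all_order all_algebra.
From mathcomp Require Import all_classical all_reals all_analysis measurable_realfun.
From mathcomp Require Import ring lra.

(** Write g = vec G, q = vec Q and let W be optimal. If G = U D V^T, then to
    first order the perturbation of W in the direction of g (|g| q - g)^T +
    (|g| q - g) g^T keeps the constraints up to a rescaling, because every
    singular value of G is at most |g|; here g lies in the range of W, so W -
    eps g g^T stays positive semidefinite for small eps. Optimality of W
    therefore gives g^T A g <= |g| g^T A q, whence, as (|g| q - g)^T A (|g| q
    - g) >= 0, q^T A q >= g^T A g / |g|^2 almost surely. Factor A = K^T K and
    let X_l be the coordinates of K g, with standard deviations sigma_l. Then
    X_l^2 / |g|^2 >= 2 c |X_l| - c^2 |g|^2 for all c; take expectations, with
    E |X_l| = sqrt (2 / pi) sigma_l and E |g|^2 = tr W = m, and optimize over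
    c. *)

Set Implicit Arguments.
Unset Strict Implicit.
Unset Printing Implicit Defensive.

Import Order.TTheory GRing.Theory Num.Theory.
Import numFieldNormedType.Exports.

Local Open Scope ring_scope.

(** * Positive semidefinite matrices *)

Section PositiveSemidefinite.
Context {R : realType}.

Lemma mx11_tr (M : 'M[R]_1) : M^T = M.
Proof. by rewrite [M]mx11_scalar tr_scalar_mx. Qed.

Lemma trmxZ p q (a : R) (M : 'M[R]_(p, q)) : (a *: M)^T = a *: M^T.
Proof. by rewrite linearZ. Qed.

Lemma gram_ge0 k (x : 'cV[R]_k) : 0 <= (x^T *m x) 0 0.
Proof. by rewrite mxE sumr_ge0 // => i _; rewrite mxE -expr2 sqr_ge0. Qed.

Lemma psdmxD d (M N : 'M[R]_d) : psdmx M -> psdmx N -> psdmx (M + N).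
Proof.
move=> [Ms M0] [Ns N0]; split; first by rewrite linearD /= Ms Ns.
by move=> x; rewrite mulmxDr mulmxDl mxE addr_ge0.
Qed.

Lemma psdmxZ d (a : R) (M : 'M[R]_d) : 0 <= a -> psdmx M -> psdmx (a *: M).
Proof.
move=> a0 [Ms M0]; split; first by rewrite trmxZ Ms.
by move=> x; rewrite -scalemxAr -scalemxAl mxE mulr_ge0.
Qed.

Lemma psdmx_gram k d (K : 'M[R]_(k, d)) : psdmx (K^T *m K).
Proof.
split=> [|x]; first by rewrite trmx_mul trmxK.
by rewrite mulmxA -mulmxA -trmx_mul gram_ge0.
Qed.

Lemma psdmx0 d : psdmx (0 : 'M[R]_d).
Proof. by split=> [|x]; rewrite ?trmx0 // mulmx0 mul0mx mxE. Qed.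

Lemma psdmx_sum d (I : finType) (F : I -> 'M[R]_d) :
  (forall i, psdmx (F i)) -> psdmx (\sum_i F i).
Proof.
by move=> F0; elim/big_ind: _ => [||i _]; [exact: psdmx0|exact: psdmxD|].
Qed.

Lemma psdmx1 d : psdmx (1%:M : 'M[R]_d).
Proof. by have := psdmx_gram (1%:M : 'M[R]_d); rewrite trmx1 mul1mx. Qed.

Lemma psdmx_bilinC d (M : 'M[R]_d) (x y : 'cV[R]_d) : M^T = M ->
  (x^T *m M *m y) 0 0 = (y^T *m M *m x) 0 0.
Proof.
by move=> Ms; rewrite -[x^T *m M *m y]mx11_tr !trmx_mul trmxK Ms mulmxA.
Qed.

(** Cholesky factorization, by induction on the dimension: split off the first row and column, with
    pivot [a], and factor the Schur complement of [a]. *)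
Lemma psdmx_factor d (M : 'M[R]_d) :
  psdmx M -> exists k, exists K : 'M[R]_(k, d), M = K^T *m K.
Proof.
elim: d M => [M _|d IH].
  by exists 0, 0; apply/matrixP => -[].
change (forall M : 'M[R]_(1 + d), psdmx M ->
  exists k, exists K : 'M[R]_(k, 1 + d), M = K^T *m K) => M.
rewrite -[M]submxK.
move: (ulsubmx M) (ursubmx M) (dlsubmx M) (drsubmx M) => a b' b C [].
rewrite tr_block_mx => /eq_block_mx[_ bE _ Cs] M0.
have {}M0 x (y : 'cV_d) :
    0 <= x ^+ 2 * a 0 0 + x * (b^T *m y) 0 0 *+ 2 + (y^T *m C *m y) 0 0.
  have := M0 (col_mx x%:M y); rewrite -bE tr_col_mx mul_row_block mul_row_col.
  rewrite tr_scalar_mx !mulmxDl !mul_scalar_mx !mul_mx_scalar.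
  have -> : y^T *m b = b^T *m y by rewrite -[LHS]mx11_tr trmx_mul trmxK.
  rewrite -!scalemxAl !mxE; congr (0 <= _); ring.
have a0 : 0 <= a 0 0.
  by have := M0 1 0; rewrite !mulmx0 !mxE mulr0 mul0rn !addr0 expr1n mul1r.
(* With a zero pivot the form at (x, b) is affine in x with slope 2 |b|^2, so nonnegativity for
   every x forces b = 0. The value x = - (c + 1) / e makes the form equal to - c - 2. *)
have b0 : a 0 0 = 0 -> b = 0.
  move=> az; have c0 : 0 <= (b^T *m C *m b) 0 0 by move: (M0 0 b); rewrite az; lra.
  have e0 := gram_ge0 b.
  set c := (b^T *m C *m b) 0 0 in c0 *; set e := (b^T *m b) 0 0 in e0.
  have ez : e = 0.
    apply/eqP; rewrite eq_le e0 andbT leNgt; apply/negP => e1.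
    have := M0 (- (c + 1) / e) b; rewrite az -/e -/c mulr0 add0r.
    by rewrite divfK ?gt_eqF //; lra.
  apply/matrixP => i j; rewrite (ord1 j) [RHS]mxE; apply/eqP.
  rewrite -sqrf_eq0 eq_le sqr_ge0 andbT -ez /e mxE (bigD1 i) //= mxE -expr2.
  by rewrite lerDl sumr_ge0 // => l _; rewrite mxE -expr2 sqr_ge0.
have [|k [K KE]] := IH (C - (a 0 0)^-1 *: (b *m b^T)).
  split=> [|y].
    by rewrite linearB /= trmxZ Cs trmx_mul trmxK.
  (* For a nonzero pivot this x minimizes the form at fixed y, and the minimum is the form of the
     Schur complement. For a zero pivot the convention 0^-1 = 0 gives x = 0 and leaves [C]
     itself. *)
  have := M0 (- (b^T *m y) 0 0 / a 0 0) y.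
  rewrite mulmxBr mulmxBl -scalemxAr -scalemxAl.
  have -> : y^T *m (b *m b^T) *m y = (b^T *m y)^T *m (b^T *m y).
    by rewrite trmx_mul trmxK !mulmxA.
  rewrite !mxE !big_ord1 !mxE; set s := \sum_i _; set t := \sum_i _.
  have [->|an0] := eqVneq (a 0 0) 0; first by rewrite invr0; lra.
  by congr (0 <= _); field.
exists (1 + k)%N, (col_mx (row_mx (Num.sqrt (a 0 0))%:M
  ((Num.sqrt (a 0 0))^-1 *: b^T)) (row_mx 0 K)).
rewrite tr_col_mx !tr_row_mx mul_row_col !mul_col_row.
rewrite trmx0 !mul0mx !mulmx0 trmxZ trmxK.
rewrite !tr_scalar_mx add_block_mx !addr0 -KE.
rewrite !mul_scalar_mx !mul_mx_scalar scale_scalar_mx !scalerA.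
rewrite -scalemxAl -scalemxAr scalerA -invfM -expr2 sqr_sqrtr // addrC subrK.
rewrite -bE -mx11_scalar; have [/[dup]/b0-> ->|an0] := eqVneq (a 0 0) 0.
  by rewrite trmx0 !scaler0.
rewrite divff ?scale1r // sqrtr_eq0 -ltNge lt_neqAle a0 andbT eq_sym //.
Qed.

Lemma psdmx_tr_ge0 d (M : 'M[R]_d) : psdmx M -> 0 <= \tr M.
Proof.
move=> /psdmx_factor[k [K ->]]; rewrite mxtrace_mulC /mxtrace.
apply: sumr_ge0 => i _.
by rewrite mxE sumr_ge0 // => j _; rewrite mxE -expr2 sqr_ge0.
Qed.

Lemma gram_tr_eq0 k d (K : 'M[R]_(k, d)) : \tr (K^T *m K) = 0 -> K = 0.
Proof.
rewrite mxtrace_mulC /mxtrace => /eqP; rewrite psumr_eq0 => [/allP K0|i _].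
  apply/matrixP => i j; have := K0 i (mem_index_enum _).
  rewrite mxE psumr_eq0 => [/allP/(_ j (mem_index_enum _))|l _]; last first.
    by rewrite mxE -expr2 sqr_ge0.
  by rewrite mxE -expr2 sqrf_eq0 mxE => /eqP.
by rewrite mxE sumr_ge0 // => j _; rewrite mxE -expr2 sqr_ge0.
Qed.

Lemma psdmx_tr_eq0 d (M : 'M[R]_d) : psdmx M -> \tr M = 0 -> M = 0.
Proof.
by move=> /psdmx_factor[k [K ->]] /gram_tr_eq0 ->; rewrite mulmx0.
Qed.

Lemma frobenius_linear p q (M N N' : 'M[R]_(p, q)) (a : R) :
  frobenius M (a *: N + N') = a * frobenius M N + frobenius M N'.
Proof. by rewrite /frobenius linearP /= linearP. Qed.

Lemma psdmx_congr k d (K : 'M[R]_(k, d)) (M : 'M[R]_k) :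
  psdmx M -> psdmx (K^T *m M *m K).
Proof.
move=> [Ms M0]; split=> [|x]; first by rewrite !trmx_mul trmxK Ms mulmxA.
by have := M0 (K *m x); rewrite trmx_mul !mulmxA.
Qed.

Lemma psdmx_diag d (D : 'rV[R]_d) :
  (forall i, 0 <= D 0 i) -> psdmx (diag_mx D).
Proof.
move=> D0; have := psdmx_gram (diag_mx (map_mx Num.sqrt D)).
rewrite tr_diag_mx mulmx_diag; congr (psdmx (diag_mx _)).
by apply/rowP => i; rewrite !mxE -expr2 sqr_sqrtr.
Qed.

Lemma mulmx_tr1E k (x y : 'cV[R]_k) : (x^T *m y) 0 0 = \sum_i x i 0 * y i 0.
Proof. by rewrite mxE; apply: eq_bigr => i _; rewrite mxE. Qed.

(** The squared norm of |y|^2 x - (x^T y) y is |y|^2 (|x|^2 |y|^2 - (x^T y)^2). The case y = 0 is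
    treated apart so that the factor |y|^2 can be cancelled. *)
Lemma cauchy_schwarz_mx k (x y : 'cV[R]_k) :
  (x^T *m y) 0 0 ^+ 2 <= (x^T *m x) 0 0 * (y^T *m y) 0 0.
Proof.
have yx : (y^T *m x) 0 0 = (x^T *m y) 0 0.
  by rewrite -[y^T *m x]mx11_tr trmx_mul trmxK.
have := gram_ge0 y; rewrite le_eqVlt => /predU1P[yz|y0].
  have -> : y = 0.
    by apply: gram_tr_eq0; rewrite [_ *m _]mx11_scalar mxtrace_scalar -yz mul0rn.
  by rewrite !mulmx0 !mxE expr0n mulr0.
have := gram_ge0 ((y^T *m y) 0 0 *: x - (x^T *m y) 0 0 *: y).
rewrite [(_ - _)^T]linearB /= !trmxZ mulmxBl !mulmxBr -!scalemxAl -!scalemxAr.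
move: yx y0; set a := y^T *m x; set b := x^T *m y.
set c := y^T *m y; set e := x^T *m x => yx y0.
have subE (u v : 'M[R]_1) : (u - v) 0 0 = u 0 0 - v 0 0 by rewrite !mxE.
have sclE t (u : 'M[R]_1) : (t *: u) 0 0 = t * u 0 0 by rewrite mxE.
rewrite !(subE, sclE) yx.
have -> : c 0 0 * (c 0 0 * e 0 0) - c 0 0 * (b 0 0 * b 0 0) -
  (b 0 0 * (c 0 0 * b 0 0) - b 0 0 * (b 0 0 * c 0 0)) =
  c 0 0 * (e 0 0 * c 0 0 - b 0 0 ^+ 2) by ring.
by rewrite pmulr_rge0 // subr_ge0.
Qed.

(** The spectral norm is at most the Frobenius norm: apply Cauchy-Schwarz to x and each row of [K],
    then sum over the rows. *)
Lemma psdmx_le_trace k d (K : 'M[R]_(k, d)) :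
  psdmx ((\tr (K^T *m K))%:M - K^T *m K).
Proof.
split=> [|x]; first by rewrite linearB /= tr_scalar_mx trmx_mul trmxK.
rewrite mulmxBr mulmxBl mul_mx_scalar -scalemxAl.
have -> : x^T *m (K^T *m K) *m x = (K *m x)^T *m (K *m x).
  by rewrite trmx_mul !mulmxA.
rewrite mxE [X in X + _]mxE [X in _ + X]mxE subr_ge0 mulmx_tr1E.
rewrite mxtrace_mulC /mxtrace mulr_suml; apply: ler_sum => i _.
have := cauchy_schwarz_mx (row i K)^T x; rewrite trmxK -row_mul.
rewrite -expr2 ![row _ _ _ _]mxE; congr (_ <= _ * _).
by rewrite !mxE; apply: eq_bigr => j _; rewrite !mxE.
Qed.

(** A vector of the form L z lies in the range of L L^T, so a small multiple of its outer square can
    be subtracted. After factoring out L, it remains that z z^T / (1 + |z|^2) is below the identity;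
    the summand 1 keeps the denominator positive when z = 0. *)
Lemma psdmx_sub_rank1 p k (L : 'M[R]_(p, k)) (z : 'cV[R]_k) :
  exists2 eps, 0 < eps &
    psdmx (L *m L^T - eps *: (L *m z *m (L *m z)^T)).
Proof.
have z0 := gram_ge0 z; exists (1 + (z^T *m z) 0 0)^-1.
  by rewrite invr_gt0 ltr_wpDr.
have -> : L *m L^T - (1 + (z^T *m z) 0 0)^-1 *: (L *m z *m (L *m z)^T) =
  L^T^T *m (1%:M - (1 + (z^T *m z) 0 0)^-1 *: (z *m z^T)) *m L^T.
  rewrite trmxK mulmxBr mulmxBl mulmx1 -scalemxAr -scalemxAl.
  by rewrite trmx_mul !mulmxA.
apply: psdmx_congr.
have -> : 1%:M - (1 + (z^T *m z) 0 0)^-1 *: (z *m z^T) =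
  (1 + (z^T *m z) 0 0)^-1 *: (1%:M + ((\tr (z^T^T *m z^T))%:M - z^T^T *m z^T)).
  rewrite trmxK addrA scalerBr; congr (_ - _).
  rewrite mxtrace_mulC [X in \tr X]mx11_scalar mxtrace_scalar mulr1n.
  by rewrite -raddfD scale_scalar_mx mulVf // gt_eqF // ltr_wpDr.
apply: psdmxZ; first by rewrite invr_ge0 addr_ge0.
by apply: psdmxD; [exact: psdmx1|exact: psdmx_le_trace].
Qed.

Lemma frobenius_outer d (M : 'M[R]_d) (x y : 'cV[R]_d) :
  frobenius M (x *m y^T) = (x^T *m M *m y) 0 0.
Proof.
rewrite /frobenius mulmxA mxtrace_mulC [X in \tr X]mx11_scalar mxtrace_scalar.
by rewrite mulr1n mulmxA -[_ *m _ *m x]mx11_tr !trmx_mul !trmxK mulmxA.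
Qed.

(** Writing N = K^T K turns the inner product into the sum of the values of the form [M] at the rows
    of [K]. *)
Lemma frobenius_ge0 d (M N : 'M[R]_d) : psdmx M -> psdmx N -> 0 <= frobenius M N.
Proof.
move=> [Ms M0] /psdmx_factor[k [K ->]].
rewrite /frobenius mulmxA mxtrace_mulC mulmxA Ms /mxtrace sumr_ge0 // => i _.
suff -> : (K *m M *m K^T) i i = ((row i K)^T^T *m M *m (row i K)^T) 0 0 by [].
rewrite trmxK -row_mul [LHS]mxE [RHS]mxE.
by apply: eq_bigr => j _; congr (_ * _); rewrite !mxE.
Qed.

End PositiveSemidefinite.

(** * First-order optimality for the relaxation *)

Section Relaxation.
Context {R : realType} {n m : nat}.
Implicit Types (W : 'M[R]_(m * n)) (X Y : 'M[R]_(n, m)).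

(** [blocksum] and [tracemx] are the two partial traces of [W], seen as an operator on the tensor
    product of R^m and R^n. The constraints bound the first by the identity and set the second equal
    to it. *)
Definition blocksum W : 'M[R]_n := \sum_(i < m) blockmx W i i.

Definition tracemx W : 'M[R]_m := \matrix_(j, j') \tr (blockmx W j j').

Lemma blocksum_linear : linear blocksum.
Proof.
move=> a W W'; rewrite /blocksum scaler_sumr -big_split; apply: eq_bigr => i _.
by apply/matrixP => k l; rewrite !mxE.
Qed.

Lemma tracemx_linear : linear tracemx.
Proof.
move=> a W W'; apply/matrixP => j j'; rewrite !mxE -mxtraceZ -mxtraceD.
by congr (\tr _); apply/matrixP => k l; rewrite !mxE.
Qed.

HB.instance Definition _ :=
  GRing.isLinear.Build R _ _ _ blocksum blocksum_linear.
HB.instance Definition _ :=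
  GRing.isLinear.Build R _ _ _ tracemx tracemx_linear.

Lemma vecE X i j : vec X (mxvec_index j i) 0 = X i j.
Proof. by rewrite mxE mxvecE mxE. Qed.

Lemma vec_linear : linear (@vec R n m).
Proof. by move=> a X Y; rewrite /vec !linearP. Qed.

HB.instance Definition _ :=
  GRing.isLinear.Build R _ _ _ (@vec R n m) vec_linear.

Lemma blockmx_vec X Y j j' :
  blockmx (vec X *m (vec Y)^T) j j' = col j X *m (col j' Y)^T.
Proof.
apply/matrixP => k l; rewrite mxE [LHS]mxE big_ord1 vecE.
by rewrite [X in _ * X]mxE vecE [RHS]mxE big_ord1 !mxE.
Qed.

Lemma blocksum_vec X Y : blocksum (vec X *m (vec Y)^T) = X *m Y^T.
Proof.
apply/matrixP => k l; rewrite summxE mxE; apply: eq_bigr => j _.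
by rewrite blockmx_vec mxE big_ord1 !mxE.
Qed.

Lemma tracemx_vec X Y : tracemx (vec X *m (vec Y)^T) = X^T *m Y.
Proof.
apply/matrixP => j j'; rewrite mxE blockmx_vec mxtrace_mulC /mxtrace big_ord1.
by rewrite !mxE; apply: eq_bigr => k _; rewrite !mxE mulrC.
Qed.

Lemma trace_tracemx W : \tr (tracemx W) = \tr (blocksum W).
Proof. by rewrite raddf_sum; apply: eq_bigr => j _; rewrite mxE. Qed.

Lemma sdp_feasibleP W : sdp_feasible W <->
  [/\ psdmx W, psdmx (1%:M - blocksum W) & tracemx W = 1%:M].
Proof.
split=> -[W0 B T]; split=> //.
  by apply/matrixP => j j'; rewrite mxE T !mxE.
by move=> j j'; move/matrixP: T => /(_ j j'); rewrite !mxE.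
Qed.

(** The witness is the Kronecker product of [C] and [D]. It is written as a sum of outer squares of
    the rank-one matrices [H k l], built from the rows of the factors of [C] and [D], so that
    positivity and both partial traces are immediate. *)
Lemma kron_psd_marginals (C : 'M[R]_m) (D : 'M[R]_n) : psdmx C -> psdmx D ->
  exists X : 'M[R]_(m * n),
    [/\ psdmx X, blocksum X = \tr C *: D & tracemx X = \tr D *: C].
Proof.
move=> /psdmx_factor[p [K ->]] /psdmx_factor[q [L ->]].
pose H k l : 'M[R]_(n, m) := (row l L)^T *m row k K.
have HB k l : H k l *m (H k l)^T = (K *m K^T) k k *: ((row l L)^T *m row l L).
  rewrite trmx_mul trmxK mulmxA -[(row l L)^T *m _ *m _]mulmxA.
  rewrite [row k K *m _]mx11_scalar mul_mx_scalar -scalemxAl; congr (_ *: _).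
  by rewrite tr_row -row_mul !mxE; apply: eq_bigr => i _; rewrite !mxE.
have HT k l : (H k l)^T *m H k l = (L *m L^T) l l *: ((row k K)^T *m row k K).
  rewrite trmx_mul trmxK mulmxA -[(row k K)^T *m _ *m _]mulmxA.
  rewrite [row l L *m _]mx11_scalar mul_mx_scalar -scalemxAl; congr (_ *: _).
  by rewrite tr_row -row_mul !mxE; apply: eq_bigr => i _; rewrite !mxE.
have rows r d (M : 'M[R]_(r, d)) : \sum_i (row i M)^T *m row i M = M^T *m M.
  apply/matrixP => i j; rewrite summxE mxE; apply: eq_bigr => k _.
  by rewrite mxE big_ord1 !mxE.
exists (\sum_k \sum_l vec (H k l) *m (vec (H k l))^T); split.
- do 2 apply: psdmx_sum => ?.
  by rewrite -[X in X *m _]trmxK; exact: psdmx_gram.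
- rewrite linear_sum mxtrace_mulC scaler_suml; apply: eq_bigr => k _.
  rewrite linear_sum -(rows _ _ L) scaler_sumr; apply: eq_bigr => l _ /=.
  by rewrite blocksum_vec HB.
- rewrite linear_sum -(rows _ _ K) scaler_sumr; apply: eq_bigr => k _.
  rewrite linear_sum mxtrace_mulC scaler_suml.
  by apply: eq_bigr => l _ /=; rewrite tracemx_vec HT.
Qed.

(* Completing by a multiple of the Kronecker product of the two slacks makes
   the trace constraint tight. *)
Lemma relaxed_feasible_complete W : (m <= n)%N ->
  psdmx W -> psdmx (1%:M - blocksum W) -> psdmx (1%:M - tracemx W) ->
  exists W', sdp_feasible W' /\ psdmx (W' - W).
Proof.
move=> mn W0 B0 T0.
have [X [X0 XB XT]] := kron_psd_marginals T0 B0.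
set b := \tr (1%:M - blocksum W) in XT; set t := \tr (1%:M - tracemx W) in XB.
(* The two partial traces of [W] have the same trace, so b - t = n - m; this is where m <= n enters.
   The correction X / b then uses up only the fraction t / b of the slack in the block sum. *)
have tb : t <= b.
  by rewrite /t /b !linearB /= trace_tracemx !mxtrace1 lerB ?ler_nat.
have t0 : 0 <= t by exact: psdmx_tr_ge0.
have b0 : 0 <= b by exact: psdmx_tr_ge0.
have X'0 : psdmx (b^-1 *: X) by apply: psdmxZ; rewrite ?invr_ge0.
exists (W + b^-1 *: X); split; last by rewrite addrAC subrr add0r.
apply/sdp_feasibleP; split; first exact: psdmxD.
- rewrite linearD linearZ /= XB opprD addrA scalerA.
  rewrite -[X in X - _]scale1r -scalerBl; apply: psdmxZ => //.
  have [->|bn0] := eqVneq b 0; first by rewrite invr0 mul0r subr0.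
  by rewrite subr_ge0 mulrC ler_pdivrMr ?mul1r // lt_neqAle eq_sym bn0.
- rewrite linearD linearZ /= XT scalerA.
  (* If b = 0 the correction vanishes by the convention 0^-1 = 0. Then t = 0 too, and the trace
     slack, positive semidefinite with zero trace, is already zero. *)
  have [bz|bn0] := eqVneq b 0; last by rewrite mulVf // scale1r addrC subrK.
  have /(psdmx_tr_eq0 T0)/eqP : t = 0.
    by apply/eqP; rewrite eq_le t0 andbT -bz.
  by rewrite bz mulr0 scale0r addr0 subr_eq0 => /eqP.
Qed.

(** Dividing by [kappa] gives a point where both constraints hold as inequalities; it lies below a
    feasible point in the Loewner order, and passing to that point cannot decrease the objective
    since [A] is positive semidefinite. *)
Lemma relaxed_optimal (A W W' : 'M[R]_(m * n)) (kappa : R) : (m <= n)%N ->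
  psdmx A -> sdp_optimal A W -> 0 < kappa ->
  psdmx W' -> psdmx (kappa%:M - blocksum W') ->
  psdmx (kappa%:M - tracemx W') ->
  frobenius A W' <= kappa * frobenius A W.
Proof.
move=> mn A0 [_ opt] k0 W0 B T.
have ki : 0 <= kappa^-1 by rewrite invr_ge0 ltW.
have sc d (M : 'M[R]_d) :
    psdmx (kappa%:M - M) -> psdmx (1%:M - kappa^-1 *: M).
  move=> /(psdmxZ ki); rewrite scalerBr scale_scalar_mx mulVf //.
  exact: lt0r_neq0.
have [||| W'' [fW'' dW]] := @relaxed_feasible_complete (kappa^-1 *: W') mn.
- exact: psdmxZ.
- by rewrite linearZ /=; exact: sc.
- by rewrite linearZ /=; exact: sc.
have := frobenius_ge0 A0 dW; have := opt _ fW''.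
have -> : W'' - kappa^-1 *: W' = (- kappa^-1) *: W' + W''.
  by rewrite scaleNr addrC.
rewrite frobenius_linear => le1 le2.
rewrite mulrC -ler_pdivrMr // mulrC; apply: le_trans le1.
by move: le2; rewrite mulNr addrC subr_ge0.
Qed.

Lemma trace_tracemxE W : \tr (tracemx W) = \tr W.
Proof.
rewrite /mxtrace [RHS](reindex _ (curry_mxvec_bij _ _)) /=.
transitivity (\sum_j \sum_k W (mxvec_index j k) (mxvec_index j k)); last first.
  by rewrite pair_bigA; apply: eq_bigr => -[].
by apply: eq_bigr => j _; rewrite mxE; apply: eq_bigr => k _; rewrite mxE.
Qed.

Lemma vec_sqr_norm X : ((vec X)^T *m vec X) 0 0 = \tr (X^T *m X).
Proof.
rewrite -tracemx_vec trace_tracemxE mxtrace_mulC.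
by rewrite [X in \tr X]mx11_scalar mxtrace_scalar.
Qed.

(** With x = vec X and y = vec Y, replace eps x x^T inside [W] by eps (x + delta y) (x + delta y)^T.
    Positivity is kept, and the sign hypotheses make the first-order change of both partial traces
    nonpositive. The constraints are thus exceeded only at order delta^2, while the objective
    changes at order delta. *)
Lemma sdp_first_order (A W : 'M[R]_(m * n)) (X Y : 'M[R]_(n, m)) (eps : R) :
  (m <= n)%N -> psdmx A -> sdp_optimal A W ->
  0 < eps -> psdmx (W - eps *: (vec X *m (vec X)^T)) ->
  psdmx (- (X *m Y^T + Y *m X^T)) -> psdmx (- (X^T *m Y + Y^T *m X)) ->
  ((vec X)^T *m A *m vec Y) 0 0 <= 0.
Proof.
move=> mn A0 Wopt eps0 WX B T.
have [/sdp_feasibleP[W0 WB WT] _] := Wopt.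
set f := \tr (Y^T *m Y).
have f0 : 0 <= f by rewrite /f -vec_sqr_norm gram_ge0.
set F := frobenius A W; have F0 : 0 <= F by exact: frobenius_ge0.
set a := (_ *m _) 0 0.
have le_delta delta : 0 < delta -> a *+ 2 <= delta * (f * F).
  (* The number f = |y|^2 bounds both Y Y^T and Y^T Y, so [K] is a scale at which the perturbed
     point satisfies both relaxed constraints. *)
  move=> d0; set K := 1 + eps * delta ^+ 2 * f.
  have ed0 : 0 <= eps * delta by rewrite mulr_ge0 ?ltW.
  have ed20 : 0 <= eps * delta ^+ 2 by rewrite mulr_ge0 ?ltW // exprn_gt0.
  pose W' := (eps * delta) *: (vec X *m (vec Y)^T + vec Y *m (vec X)^T) +
    ((eps * delta ^+ 2) *: (vec Y *m (vec Y)^T) + W).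
  have W'0 : psdmx W'.
    have -> : W' = (W - eps *: (vec X *m (vec X)^T)) +
      eps *: ((vec X + delta *: vec Y) *m (vec X + delta *: vec Y)^T).
      rewrite /W'; move: (vec X) (vec Y) => x y.
      by apply/matrixP => i j; rewrite !mxE !big_ord1 !mxE; ring.
    apply: psdmxD => //; apply: psdmxZ; first exact: ltW.
    by rewrite -[X in X *m _]trmxK; exact: psdmx_gram.
  have K0 : 0 < K by rewrite ltr_wpDr // mulr_ge0.
  have fP : psdmx (f%:M - Y *m Y^T).
    by have := psdmx_le_trace Y^T; rewrite trmxK mxtrace_mulC.
  have fT : psdmx (f%:M - Y^T *m Y) by exact: psdmx_le_trace.
  have KE p (M N S : 'M[R]_p) : psdmx (- N) -> psdmx (f%:M - S) ->
      psdmx (1%:M - M) ->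
      psdmx (K%:M - ((eps * delta) *: N + ((eps * delta ^+ 2) *: S + M))).
    move=> N0 S0 M0; have -> : K%:M -
        ((eps * delta) *: N + ((eps * delta ^+ 2) *: S + M)) =
        (1%:M - M) + (eps * delta) *: (- N) +
        (eps * delta ^+ 2) *: (f%:M - S).
      by apply/matrixP => i j; rewrite !mxE /K; case: eqP => _; ring.
    by apply: psdmxD; [apply: psdmxD => //|]; apply: psdmxZ.
  have := @relaxed_optimal A W W' K mn A0 Wopt K0 W'0.
  have -> : blocksum W' = (eps * delta) *: (X *m Y^T + Y *m X^T) +
      ((eps * delta ^+ 2) *: (Y *m Y^T) + blocksum W).
    by rewrite /W' !linearP /= linearD /= !blocksum_vec.
  have -> : tracemx W' = (eps * delta) *: (X^T *m Y + Y^T *m X) +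
      ((eps * delta ^+ 2) *: (Y^T *m Y) + 1%:M).
    by rewrite /W' !linearP /= linearD /= !tracemx_vec WT.
  rewrite /W'; move=> /(_ (KE _ _ _ _ B fP WB)).
  have T1 : psdmx (1%:M - 1%:M : 'M[R]_m) by rewrite subrr; exact: psdmx0.
  move=> /(_ (KE _ _ _ _ T fT T1)); rewrite !frobenius_linear.
  have -> : frobenius A (vec X *m (vec Y)^T + vec Y *m (vec X)^T) = a *+ 2.
    rewrite -[vec X *m _]scale1r frobenius_linear !frobenius_outer.
    by rewrite (psdmx_bilinC (vec Y)) ?(proj1 A0) // mul1r mulr2n.
  rewrite frobenius_outer -/F; have b0 := proj2 A0 (vec Y).
  rewrite /K mulrDl mul1r => le1.
  have {}le1 : eps * delta * (a *+ 2) <= eps * delta * (delta * (f * F)).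
    have -> : eps * delta * (delta * (f * F)) = eps * delta ^+ 2 * f * F by ring.
    by have := mulr_ge0 ed20 b0; move: le1; rewrite -/F; lra.
  by move: le1; rewrite ler_pM2l // mulr_gt0.
rewrite leNgt; apply/negP => a0.
have fF : 0 <= f * F by exact: mulr_ge0.
have fF1 : 0 < f * F + 1 by rewrite ltr_wpDl.
(* A delta this small would give 2 a (f F + 1) <= a f F, impossible for a > 0; the summand 1 guards
   against f F = 0. *)
have := le_delta (a / (f * F + 1)); rewrite divr_gt0 // => /(_ isT).
rewrite mulrAC ler_pdivlMr // mulr2n => le1.
have : 0 <= a * (f * F) by rewrite mulr_ge0 // ltW.
by lra.
Qed.

(** The first-order condition is used in the direction X - N Y, where Y is the polar factor of X and
    N is the norm of vec X. *)
Lemma polar_rounding_lower_bound (A : 'M[R]_(m * n)) k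
    (L : 'M[R]_(m * n, k)) (z : 'cV[R]_k) (X U : 'M[R]_(n, m)) (D V : 'M[R]_m) :
  (m <= n)%N -> psdmx A -> sdp_optimal A (L *m L^T) ->
  vec X = L *m z -> is_svd X U D V ->
  ((vec X)^T *m A *m vec X) 0 0 / ((vec X)^T *m vec X) 0 0 <=
  ((vec (U *m V^T))^T *m A *m vec (U *m V^T)) 0 0.
Proof.
move=> mn A0 Wopt Xz [XE UU /diag_mxP[s sE] D0 VV].
set Y := U *m V^T; set N2 := ((vec X)^T *m vec X) 0 0.
have N20 : 0 <= N2 by exact: gram_ge0.
have N2E : N2 = \sum_i s 0 i ^+ 2.
  rewrite /N2 vec_sqr_norm XE !trmx_mul trmxK sE tr_diag_mx.
  rewrite -!mulmxA (mulmxA U^T) UU mul1mx mxtrace_mulC -!mulmxA VV mulmx1.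
  by rewrite mulmx_diag mxtrace_diag; apply: eq_bigr => i _; rewrite mxE expr2.
(* For X = 0 the quotient is 0 by the convention on division, and the bound is the positivity of
   [A]. *)
have := N20; rewrite le_eqVlt => /predU1P[<-|N2gt0].
  by rewrite invr0 mulr0; exact: (proj2 A0).
pose N := Num.sqrt N2; have Ngt0 : 0 < N by rewrite sqrtr_gt0.
have NN : N ^+ 2 = N2 by rewrite sqr_sqrtr.
have [eps eps0 WX] := psdmx_sub_rank1 L z; rewrite -Xz in WX.
have s0 i : 0 <= s 0 i by have := D0 i; rewrite sE mxE eqxx.
(* N is the Frobenius norm of X, hence at least each singular value. So N s - s^2 >= 0, and these
   are the diagonal entries to which the two sign conditions reduce after conjugation by [U] and
   [V]. *)
have sN i : s 0 i <= N.
  rewrite -(@ler_pXn2r _ 2) ?nnegrE ?(ltW Ngt0) // NN N2E.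
  by rewrite (bigD1 i) //= lerDl sumr_ge0 // => j _; rewrite sqr_ge0.
have psdE : psdmx (diag_mx (\row_i (N * s 0 i - s 0 i ^+ 2))).
  apply: psdmx_diag => i; rewrite mxE subr_ge0 expr2.
  by apply: ler_wpM2r.
have XV : X = U *m diag_mx s *m V^T by rewrite XE sE.
have diagE : N *: diag_mx s - diag_mx s *m diag_mx s =
    diag_mx (\row_i (N * s 0 i - s 0 i ^+ 2)).
  rewrite mulmx_diag -linearZ -linearB /=; congr diag_mx.
  by apply/rowP => i; rewrite !mxE.
have BE : - (X *m (X - N *: Y)^T) =
    U^T^T *m diag_mx (\row_i (N * s 0 i - s 0 i ^+ 2)) *m U^T.
  rewrite trmxK -diagE [(_ - _)^T]linearB /= trmxZ mulmxBr opprB.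
  rewrite -scalemxAr XV /Y !trmx_mul !trmxK tr_diag_mx.
  rewrite -!mulmxA !(mulmxA V^T) !VV !mul1mx mulmxBl mulmxBr.
  by rewrite -scalemxAl -scalemxAr !mulmxA.
have TE : - (X^T *m (X - N *: Y)) =
    V^T^T *m diag_mx (\row_i (N * s 0 i - s 0 i ^+ 2)) *m V^T.
  rewrite trmxK -diagE mulmxBr opprB.
  rewrite -scalemxAr XV /Y !trmx_mul !trmxK tr_diag_mx.
  rewrite -!mulmxA !(mulmxA U^T) !UU !mul1mx mulmxBl mulmxBr.
  by rewrite -scalemxAl -scalemxAr !mulmxA.
have sym p (M : 'M[R]_p) : psdmx (- M) -> psdmx (- (M + M^T)).
  move=> M0; rewrite opprD -linearN /= (proj1 M0).
  exact: psdmxD.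
have le1 : ((vec X)^T *m A *m vec (X - N *: Y)) 0 0 <= 0.
  apply: sdp_first_order Wopt eps0 WX _ _ => //.
  - rewrite -[X in _ + X]trmxK trmx_mul trmxK; apply: sym.
    by rewrite BE; apply: psdmx_congr.
  - rewrite -[X in _ + X]trmxK trmx_mul trmxK; apply: sym.
    by rewrite TE; apply: psdmx_congr.
have subE (u v : 'M[R]_1) : (u - v) 0 0 = u 0 0 - v 0 0 by rewrite !mxE.
have sclE t (u : 'M[R]_1) : (t *: u) 0 0 = t * u 0 0 by rewrite mxE.
move: le1; rewrite linearB linearZ /= mulmxBr -scalemxAr subE sclE.
(* With x^T A x <= N x^T A y, expanding (N y - x)^T A (N y - x) >= 0 gives N^2 y^T A y >= 2 N x^T A
   y - x^T A x >= x^T A x. *)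
have := proj2 A0 (N *: vec Y - vec X).
rewrite [(_ - _)^T]linearB /= trmxZ !mulmxBl !mulmxBr -!scalemxAl -!scalemxAr.
rewrite !(subE, sclE) (psdmx_bilinC (vec Y) (vec X)) ?(proj1 A0) //.
by rewrite ler_pdivrMr // -NN; lra.
Qed.

End Relaxation.

(** * Rotation invariance of the Gaussian measure *)

Section NormalLaw.
Context {R : realType}.
Local Open Scope classical_set_scope.
Local Notation mu := (@lebesgue_measure R).
Local Notation mR := (measurableTypeR R).

Definition measure_pushforward d d' (T : measurableType d)
    (T' : measurableType d') (P : {measure set T -> \bar R}) (f : T -> T')
    (mf : measurable_fun setT f) : {measure set T' -> \bar R} :=
  ltac:(refine (pushforward P f); exact: mf).

Lemma measurable_affine (b c : R) :
  measurable_fun [set: mR] ((fun y => b * y + c) : mR -> mR).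
Proof.
by apply: measurable_funD => //; apply: measurable_funM.
Qed.

Lemma affine_preimage_itvoc (b c s t : R) : b != 0 ->
  (fun y : R => b * y + c) @^-1` `]s, t] =
  if 0 < b then `](s - c) / b, (t - c) / b]
  else `[(t - c) / b, (s - c) / b[.
Proof.
move=> b0; apply/seteqP; case: ltgtP b0 => // b0 _; split=> y /=;
  rewrite !in_itv /= -?ltrBlDr -?lerBrDr.
- by rewrite ltr_pdivrMr // ler_pdivlMr // ![_ * b]mulrC.
- by rewrite ltr_pdivrMr // ler_pdivlMr // ![_ * b]mulrC.
- by rewrite ltr_ndivlMr // ler_ndivrMr // ![_ * b]mulrC andbC.
- by rewrite ltr_ndivlMr // ler_ndivrMr // ![_ * b]mulrC andbC.
Qed.

(** By uniqueness of Lebesgue measure it suffices to compare half-open intervals. A negative [b]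
    moves the closed end to the other side without changing the length. *)
Lemma lebesgue_measure_affine (b c : R) : b != 0 ->
  forall A : set mR, measurable A ->
  mu A = (`|b|%:E * pushforward mu ((fun y => b * y + c)%R : mR -> mR) A)%E.
Proof.
move=> b0 A mA; have mh := measurable_affine b c.
pose ph : {measure set mR -> \bar R} := measure_pushforward mu mh.
apply: (@lebesgue_measure_unique R (mscale (NngNum (normr_ge0 b)) ph)) => //.
move=> _ [[s t]] _ <-.
change (mu `]s, t] =
  `|b|%:E * mu ((fun y => b * y + c)%R @^-1` `]s, t]))%E.
rewrite (affine_preimage_itvoc c s t b0) lebesgue_measure_itv /= lte_fin.
have bE u v : (u - c) / b - (v - c) / b = (u - v) / b.
  by rewrite -mulrBl; congr (_ / _); ring.
case: (ltgtP b 0) b0 => // b0 _; rewrite /= lebesgue_measure_itv /= !lte_fin.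
- rewrite ltr_nM2r ?invr_lt0 // ltrD2r; case: ifP => _; last by rewrite mule0.
  rewrite -!EFinB -EFinM bE ltr0_norm //; congr EFin.
  by field; rewrite lt_eqF.
- rewrite ltr_pM2r ?invr_gt0 // ltrD2r; case: ifP => _; last by rewrite mule0.
  rewrite -!EFinB -EFinM bE gtr0_norm //; congr EFin.
  by field; rewrite gt_eqF.
Qed.

Lemma ge0_integral_affine (b c : R) (f : mR -> \bar R) : b != 0 ->
  measurable_fun setT f -> (forall x, 0 <= f x)%E ->
  (\int[mu]_x f x = `|b|%:E * \int[mu]_x f (b * x + c)%R)%E.
Proof.
move=> b0 mf f0; have mh := measurable_affine b c.
pose ph : {measure set mR -> \bar R} := measure_pushforward mu mh.
rewrite (eq_measure_integral (mscale (NngNum (normr_ge0 b)) ph)); last first.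
  by move=> A mA _; exact: lebesgue_measure_affine.
rewrite ge0_integral_mscale //=; congr (_ * _)%E.
by rewrite ge0_integral_pushforward.
Qed.

(** The Radon-Nikodym derivative of the normal law and [normal_pdf] have the same integral over
    every measurable set, hence agree almost everywhere. *)
Lemma ge0_integral_normal_prob (c s : R) (f : mR -> \bar R) :
  measurable_fun setT f -> (forall x, 0 <= f x)%E ->
  (\int[normal_prob c s]_x f x = \int[mu]_x (f x * (normal_pdf c s x)%:E))%E.
Proof.
move=> mf f0; have dom := @normal_prob_dominates R c s.
have mpdf : measurable_fun setT (fun x : mR => (normal_pdf c s x)%:E).
  by apply/measurable_EFinP; exact: measurable_normal_pdf.
rewrite -(Radon_Nikodym_SigmaFinite.change_of_variables dom) //.
have intf := Radon_Nikodym_SigmaFinite.f_integrable dom.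
have mg := measurable_int _ intf.
apply: ae_eq_integral => //; try exact: emeasurable_funM.
have : ae_eq mu setT (Radon_Nikodym_SigmaFinite.f (normal_prob c s) mu)
    (fun x => (normal_pdf c s x)%:E).
  apply: integral_ae_eq => // E _ mE.
  by rewrite -(Radon_Nikodym_SigmaFinite.f_integral dom).
by apply: filterS => x /[apply] ->.
Qed.

(** Affine change of variables in the density. A negative [b] is allowed as a scale, since the
    density depends on it through b^2. *)
Lemma normal_prob_affine (b c : R) (B : set mR) : b != 0 -> measurable B ->
  normal_prob 0 1 ((fun y : mR => b * y + c : mR) @^-1` B) = normal_prob c b B.
Proof.
move=> b0 mB; rewrite /normal_prob.
have mpdf : measurable_fun setT (fun x : mR => (normal_pdf c b x)%:E).
  by apply/measurable_EFinP; exact: measurable_normal_pdf.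
rewrite [LHS]integral_mkcond [RHS]integral_mkcond.
rewrite [RHS](@ge0_integral_affine b c) //; last 2 first.
- by apply/(measurable_restrictT _ _).1 => //; exact: measurable_funTS.
- by move=> x; rewrite patchE; case: ifP => // _; rewrite lee_fin normal_pdf_ge0.
rewrite -ge0_integralZl_EFin //; last 2 first.
- by move=> x _; rewrite patchE; case: ifP => // _; rewrite lee_fin normal_pdf_ge0.
- apply: (measurableT_comp _ (measurable_affine b c)).
  by apply/(measurable_restrictT _ _).1 => //; exact: measurable_funTS.
apply: eq_integral => x _; rewrite !patchE.
have -> : (x \in (fun y : mR => b * y + c : mR) @^-1` B) = (b * x + c \in B).
  by apply/idP/idP; rewrite !inE.
case: ifP => _; last by rewrite mule0.
rewrite -EFinM; congr EFin; rewrite !normal_pdfE ?oner_neq0 //.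
rewrite mulrA; congr (_ * _).
  rewrite /normal_peak expr1n mul1r -!mulrnAr sqrtrM ?sqr_ge0 // sqrtr_sqr.
  by rewrite invfM mulrA divff ?normr_eq0 // mul1r.
rewrite /normal_fun; congr expR; rewrite subr0 addrK exprMn.
by field.
Qed.

(** For independent standard normal X and Y and U = a X + b Y, both sides are the joint density of
    (X, U): law of X times law of U given X, and law of U times law of X given U. The proof
    completes the square in the exponent. *)
Lemma normal_pdf_disintegration (a b x u : R) : b != 0 ->
  let r2 := a ^+ 2 + b ^+ 2 in
  normal_pdf 0 1 x * normal_pdf (a * x) b u =
  normal_pdf 0 (Num.sqrt r2) u *
  normal_pdf (a * u / r2) (b / Num.sqrt r2) x.
Proof.
move=> b0 r2; have b20 : 0 < b ^+ 2 by rewrite exprn_even_gt0.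
have r20 : 0 < r2 by rewrite ltr_wpDl ?sqr_ge0.
have r0 : 0 < Num.sqrt r2 by rewrite sqrtr_gt0.
have rn0 : Num.sqrt r2 != 0 by rewrite gt_eqF.
rewrite !normal_pdfE ?oner_neq0 ?mulf_neq0 ?invr_neq0 //.
rewrite mulrACA [RHS]mulrACA; congr (_ * _).
  rewrite /normal_peak -!invfM -!sqrtrM ?mulrn_wge0 ?mulr_ge0 ?sqr_ge0 ?pi_ge0 //.
  rewrite expr_div_n sqr_sqrtr ?ltW //; congr (Num.sqrt _)^-1.
  by rewrite expr1n mul1r; field; rewrite gt_eqF.
rewrite /normal_fun -!expRD; congr expR.
rewrite expr_div_n sqr_sqrtr ?ltW // /r2.
by field; rewrite b0 gt_eqF.
Qed.

(** Integrate the joint density of (X, a X + b Y) in the other order: by the disintegration, the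
    conditional law of X integrates to 1 and the marginal of a X + b Y remains. *)
Lemma normal_prob_rotation (a b : R) (B : set mR) : 0 <= a -> measurable B ->
  (normal_prob 0 1 \x normal_prob 0 1)%E
    ((fun z : mR * mR => a * z.1 + b * z.2 : mR) @^-1` B) =
  normal_prob 0 1 ((fun z : mR => Num.sqrt (a ^+ 2 + b ^+ 2) * z : mR) @^-1` B).
Proof.
move=> a0 mB; pose h (z : mR * mR) : mR := a * z.1 + b * z.2.
have mh : measurable_fun setT h.
  by apply: measurable_funD; apply: measurable_funM.
have mA : measurable (h @^-1` B) by rewrite -[X in measurable X]setTI; exact: mh.
rewrite /product_measure1 /=.
have secE x : xsection (h @^-1` B) x = (fun y : mR => b * y + a * x : mR) @^-1` B.
  by apply/seteqP; split=> y; rewrite /xsection /= inE /h /= addrC.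
have mpdf c s : measurable_fun setT (fun x : mR => (normal_pdf c s x)%:E).
  by apply/measurable_EFinP; exact: measurable_normal_pdf.
(* For b = 0 the law of a X + b Y given X has no density; here the claim is direct, as sqrt (a^2) =
   a for a >= 0. *)
have [bz|b0] := eqVneq b 0.
  rewrite bz expr0n addr0 sqrtr_sqr -bz -/h ger0_norm //.
  set C := (fun z : mR => a * z : mR) @^-1` B; have mC : measurable C.
    rewrite -[C]setTI; suff mf : measurable_fun setT (fun z : mR => a * z : mR).
      exact: (mf measurableT _ mB).
    exact: measurable_funM.
  rewrite -[C in RHS]setIT -integral_indic //; apply: eq_integral => x _ /=.
  have -> : xsection (h @^-1` B) x = [set y | C x].
    by rewrite secE bz; apply/seteqP; split=> y; rewrite /C /= mul0r add0r.
  rewrite indicE; case: (pselect (C x)) => Cx.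
    rewrite mem_set // (_ : [set _ | _] = setT) ?probability_setT //.
    by apply/seteqP; split.
  rewrite memNset // (_ : [set _ | _] = set0) ?measure0 //.
  by apply/seteqP; split.
have r20 : 0 < a ^+ 2 + b ^+ 2 by rewrite ltr_wpDl ?sqr_ge0 ?exprn_even_gt0.
have r0 : Num.sqrt (a ^+ 2 + b ^+ 2) != 0 by rewrite gt_eqF ?sqrtr_gt0.
rewrite ge0_integral_normal_prob //; last first.
  exact: (measurable_fun_xsection _ mA).
pose r2 := a ^+ 2 + b ^+ 2.
pose f (z : mR * mR) := ((\1_B z.2 * normal_pdf 0 (Num.sqrt r2) z.2) *
  normal_pdf (a * z.2 / r2) (b / Num.sqrt r2) z.1)%:E.
transitivity (\int[mu]_x \int[mu]_u f (x, u))%E.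
  apply: eq_integral => x _; rewrite /= secE normal_prob_affine // /normal_prob.
  rewrite muleC -ge0_integralZl_EFin ?normal_pdf_ge0 //; last 2 first.
  - by move=> u _; rewrite lee_fin normal_pdf_ge0.
  - exact: measurable_funTS.
  rewrite integral_mkcond; apply: eq_integral => u _.
  rewrite patchE /f /= -mulrA -normal_pdf_disintegration // indicE.
  by case: (u \in B); rewrite ?mul1r ?mul0r.
rewrite fubini_tonelli; last 2 first.
- apply/measurable_EFinP; apply: measurable_funM.
    apply: measurable_funM; first exact: measurableT_comp.
    by apply: (measurableT_comp (measurable_normal_pdf _ _)).
  (* The mean varies with the second coordinate, so joint measurability is read off the explicit
     formula of the density. *)
  apply: (eq_measurable_fun (fun z : mR * mR =>
      normal_peak (b / Num.sqrt r2) *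
      normal_fun (a * z.2 / r2) (b / Num.sqrt r2) z.1)) => [z _|].
    by rewrite normal_pdfE // mulf_neq0 ?invr_neq0.
  apply: measurable_funM => //.
  apply: measurableT_comp => //; apply: measurable_funM => //.
  apply: measurableT_comp => //; apply: measurable_funX.
  apply: measurable_funB => //; apply: measurable_funM => //.
  exact: measurable_funM.
- by move=> z; rewrite lee_fin !mulr_ge0 ?normal_pdf_ge0.
transitivity (\int[mu]_(u in B) (normal_pdf 0 (Num.sqrt r2) u)%:E)%E.
  rewrite [RHS]integral_mkcond; apply: eq_integral => u _.
  under eq_integral do rewrite /f /= EFinM.
  rewrite ge0_integralZl_EFin ?mulr_ge0 ?normal_pdf_ge0 //; last first.
    by move=> x _; rewrite lee_fin normal_pdf_ge0.
  rewrite integral_normal_pdf mule1 patchE indicE.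
  by case: (u \in B); rewrite ?mul1r ?mul0r.
rewrite -/(normal_prob _ _ _) -(normal_prob_affine 0 r0 mB).
by congr (normal_prob _ _ _); apply/seteqP; split=> y /=; rewrite addr0.
Qed.

End NormalLaw.

(** * Moments of the standard normal law *)

Section NormalMoments.
Context {R : realType}.
Local Open Scope classical_set_scope.
Local Notation mu := (@lebesgue_measure R).
Local Notation mR := (measurableTypeR R).

Lemma std_normal_pdfE (x : R) :
  normal_pdf 0 1 x = (Num.sqrt (pi *+ 2))^-1 * expR (- x ^+ 2 / 2).
Proof.
by rewrite normal_pdfE ?oner_neq0 // /normal_peak /normal_fun expr1n mul1r subr0.
Qed.

(* This is [1 + y <= expR y] at y = x^2 / 2 * (1 - 1 / s^2); letting s tend to 1
   bounds the second moment of the normal law by 1. *)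
Lemma sqr_mul_pdf_le (s x : R) : 1 < s ->
  x ^+ 2 * normal_pdf 0 1 x + 2 * s ^+ 2 / (s ^+ 2 - 1) * normal_pdf 0 1 x <=
  2 * s ^+ 3 / (s ^+ 2 - 1) * normal_pdf 0 s x.
Proof.
move=> s1; have s0 : 0 < s by exact: lt_trans s1.
have s21 : 0 < s ^+ 2 - 1 by rewrite subr_gt0 expr_gt1 // ltW.
have pE : normal_pdf 0 s x =
    s^-1 * (normal_pdf 0 1 x * expR (x ^+ 2 / 2 * (1 - (s ^+ 2)^-1))).
  rewrite std_normal_pdfE normal_pdfE ?gt_eqF // /normal_peak /normal_fun subr0.
  rewrite -mulrnAr sqrtrM ?sqr_ge0 // sqrtr_sqr gtr0_norm // invfM.
  rewrite -!mulrA -expRD; congr (_ * (_ * expR _)).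
  by field; rewrite gt_eqF.
rewrite pE -mulrDl; set p := normal_pdf 0 1 x.
have -> : 2 * s ^+ 3 / (s ^+ 2 - 1) *
    (s^-1 * (p * expR (x ^+ 2 / 2 * (1 - (s ^+ 2)^-1)))) =
    (2 * s ^+ 2 / (s ^+ 2 - 1) * expR (x ^+ 2 / 2 * (1 - (s ^+ 2)^-1))) * p.
  by field; rewrite !gt_eqF.
rewrite ler_wpM2r ?normal_pdf_ge0 //.
have k0 : 0 <= 2 * s ^+ 2 / (s ^+ 2 - 1).
  by rewrite divr_ge0 ?ltW // mulr_gt0 // exprn_gt0.
have := ler_wpM2l k0 (expR_ge1Dx (x ^+ 2 / 2 * (1 - (s ^+ 2)^-1))).
move=> /(le_trans _); apply; rewrite le_eqVlt; apply/orP; left; apply/eqP.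
by field; rewrite !gt_eqF.
Qed.

Lemma integral_sqr_normal_le1 :
  (\int[normal_prob 0 1]_x (x ^+ 2)%:E <= 1 :> \bar R)%E.
Proof.
have msq : measurable_fun setT (fun x : mR => (x ^+ 2)%:E).
  by apply/measurable_EFinP; exact: measurable_funX.
have mpdf c s : measurable_fun setT (fun x : mR => (normal_pdf c s x)%:E).
  by apply/measurable_EFinP; exact: measurable_normal_pdf.
have sq0 (x : R) : (0 <= (x ^+ 2)%:E)%E by rewrite lee_fin sqr_ge0.
rewrite ge0_integral_normal_prob //.
set I := (\int[mu]_x _)%E.
have I0 : (0 <= I)%E.
  apply: integral_ge0 => x _; rewrite -EFinM lee_fin mulr_ge0 ?sqr_ge0 //.
  exact: normal_pdf_ge0.
(* Integrating the pointwise bound gives I <= (2 s^3 - 2 s^2) / (s^2 - 1) = 2 s^2 / (s + 1), which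
   is at most s^2. *)
have Ile (s : R) : 1 < s -> (I <= (s ^+ 2)%:E)%E.
  move=> s1; have s0 : 0 < s by exact: lt_trans s1.
  have s21 : 0 < s ^+ 2 - 1 by rewrite subr_gt0 expr_gt1 // ltW.
  have c0 : 0 <= 2 * s ^+ 2 / (s ^+ 2 - 1).
    by rewrite divr_ge0 ?ltW // mulr_gt0 // exprn_gt0.
  have c1 : 0 <= 2 * s ^+ 3 / (s ^+ 2 - 1).
    by rewrite divr_ge0 ?ltW // mulr_gt0 // exprn_gt0.
  have le1 : (I + (2 * s ^+ 2 / (s ^+ 2 - 1))%:E <=
      (2 * s ^+ 3 / (s ^+ 2 - 1))%:E)%E.
    have -> : (2 * s ^+ 2 / (s ^+ 2 - 1))%:E =
      (\int[mu]_x ((2 * s ^+ 2 / (s ^+ 2 - 1))%:E * (normal_pdf 0 1 x)%:E))%E.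
      rewrite ge0_integralZl_EFin ?integral_normal_pdf ?mule1 // => x _.
      by rewrite lee_fin normal_pdf_ge0.
    have -> : (2 * s ^+ 3 / (s ^+ 2 - 1))%:E =
      (\int[mu]_x ((2 * s ^+ 3 / (s ^+ 2 - 1))%:E * (normal_pdf 0 s x)%:E))%E.
      rewrite ge0_integralZl_EFin ?integral_normal_pdf ?mule1 // => x _.
      by rewrite lee_fin normal_pdf_ge0.
    have mx2 : measurable_fun setT
        (fun x : mR => (x ^+ 2)%:E * (normal_pdf 0 1 x)%:E)%E.
      exact: emeasurable_funM.
    have mk k c t : measurable_fun setT
        (fun x : mR => k%:E * (normal_pdf c t x)%:E)%E.
      exact: emeasurable_funM.
    have x20 (x : mR) : setT x ->
        (0 <= (x ^+ 2)%:E * (normal_pdf 0 1 x)%:E)%E.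
      by move=> _; rewrite -EFinM lee_fin mulr_ge0 ?sqr_ge0 ?normal_pdf_ge0.
    have pk0 (x : mR) : setT x -> (0 <=
        (2 * s ^+ 2 / (s ^+ 2 - 1))%:E * (normal_pdf 0 1 x)%:E)%E.
      by move=> _; rewrite -EFinM lee_fin mulr_ge0 ?normal_pdf_ge0.
    rewrite -(ge0_integralD mu measurableT x20 mx2 pk0 (mk _ _ _)).
    apply: ge0_le_integral => //.
    - by move=> x xT; rewrite adde_ge0 ?x20 ?pk0.
    - exact: emeasurable_funD.
    - by move=> x _; rewrite -!EFinM -EFinD lee_fin sqr_mul_pdf_le.
  move: I0 le1; case: I => [i| |] //; rewrite -EFinD !lee_fin => i0.
  rewrite -lerBrDr -mulrBl => /le_trans; apply.
  have -> : (2 * s ^+ 3 - 2 * s ^+ 2) / (s ^+ 2 - 1) = 2 * s ^+ 2 / (s + 1).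
    by field; rewrite !gt_eqF // addr_gt0.
  rewrite ler_pdivrMr ?addr_gt0 // mulrC ler_wpM2l ?sqr_ge0 //; lra.
have Ioo : I \is a fin_num.
  rewrite ge0_fin_numE //; apply: le_lt_trans (Ile 2 _) _; rewrite ?ltry //.
  by rewrite ltr1n.
rewrite -(fineK Ioo) lee_fin; apply/ler_addgt0Pr => e e0.
have z0 : 0 < 1 + e by exact: addr_gt0.
rewrite -lee_fin fineK //; have := Ile (Num.sqrt (1 + e)).
rewrite sqr_sqrtr; last exact: ltW.
apply; by rewrite -[ltLHS]sqrtr1 ltr_sqrt // ltrDl.
Qed.


Lemma is_derive_std_normal_pdf (x : R) :
  is_derive x 1 (fun y : R => - normal_pdf 0 1 y) (x * normal_pdf 0 1 x).
Proof.
have -> : (fun y : R => - normal_pdf 0 1 y) =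
    (fun y => - (Num.sqrt (pi *+ 2))^-1 * expR (- y ^+ 2 / 2)).
  by apply/funext => y; rewrite std_normal_pdfE [RHS]mulNr.
apply: is_derive_eq.
rewrite std_normal_pdfE /GRing.scale /=.
move: (Num.sqrt _)^-1 (expR _) => p e; by field.
Qed.

Lemma cvg_std_normal_pdf : normal_pdf 0 1 x @[x --> +oo] --> (0 : R).
Proof.
have -> : (normal_pdf 0 1 : R -> R) =
    (fun y => (Num.sqrt (pi *+ 2))^-1 * gauss_fun ((Num.sqrt 2)^-1 * y)).
  apply/funext => y; rewrite std_normal_pdfE /gauss_fun exprMn exprVn.
  by rewrite sqr_sqrtr //; congr (_ * expR _); field.
rewrite -[0 in X in _ --> X](mulr0 (Num.sqrt (pi *+ 2) : R)^-1).
apply: cvgM; first exact: cvg_cst.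
apply: (cvg_comp (fun y => (Num.sqrt 2)^-1 * y) gauss_fun); last exact: cvg_gauss_fun.
by apply: gt0_cvgMry => //; rewrite invr_gt0 sqrtr_gt0.
Qed.

(** By symmetry this is twice the integral of x times the density over the half-line, where minus
    the density is an antiderivative; the value is twice the density at 0. *)
Lemma integral_abs_normal :
  (\int[normal_prob 0 1]_x `|x|%:E = (2 / Num.sqrt (pi *+ 2))%:E :> \bar R)%E.
Proof.
have mabs : measurable_fun setT (fun x : mR => `|x|%:E).
  by apply/measurable_EFinP; exact: normr_measurable.
rewrite ge0_integral_normal_prob //.
pose f (x : R) := `|x| * normal_pdf 0 1 x.
have f0 x : 0 <= f x by rewrite mulr_ge0 // normal_pdf_ge0.
have cf : continuous f.
  move=> x; apply: cvgM; first exact: norm_continuous.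
  by apply: continuous_normal_pdf; rewrite oner_neq0.
have -> : (fun x : R => `|x|%:E * (normal_pdf 0 1 x)%:E)%E = EFin \o f.
  by apply/funext => x; rewrite /= /f EFinM.
rewrite (@ge0_symfun_integralT _ f) //; last first.
  by move=> x; rewrite /f /= normrN !std_normal_pdfE sqrrN.
have -> : [set x : R | 0 <= x] = `[0, +oo[ by rewrite set_itvcy.
rewrite (@ge0_continuous_FTC2y _ f (fun x => - normal_pdf 0 1 x) 0 (- 0)) //.
- rewrite oppr0 sub0e std_normal_pdfE expr0n oppr0 mul0r expR0 mulr1.
  by rewrite EFinN oppeK -EFinM.
- exact: continuous_subspaceT.
- by apply: cvgN; exact: cvg_std_normal_pdf.
- by move=> x _; have := is_derive_std_normal_pdf x; case.
- apply: cvg_at_right_filter; apply: cvgN.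
  by apply: continuous_normal_pdf; rewrite oner_neq0.
- move=> x; rewrite in_itv /= andbT => x0.
  rewrite derive1E; have [_ ->] := is_derive_std_normal_pdf x.
  by rewrite /f gtr0_norm.
Qed.

End NormalMoments.

(** * Linear combinations of independent normal variables *)

Section LinearCombination.
Context {R : realType} {d : measure_display} {T : measurableType d}.
Context (P : probability T R) {k : nat}.
Local Open Scope classical_set_scope.
Local Notation mR := (measurableTypeR R).
Local Notation gamma := (normal_prob (0 : R) 1).
Variable Z : 'I_k -> {RV P >-> R}.
Hypothesis HZ : standard_normal_family Z.
Implicit Types (s : 'I_k -> R) (B : 'I_k -> set R).

Definition mfun_of d1 d2 (T1 : measurableType d1) (T2 : measurableType d2)
    (f : T1 -> T2) (mf : measurable_fun setT f) : {mfun T1 >-> T2} :=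
  HB.pack f (isMeasurableFun.Build _ _ _ _ f mf).

Lemma measurable_lincomb s :
  measurable_fun setT (fun t => \sum_i s i * Z i t).
Proof. by apply: measurable_sum => i; apply: measurable_funM. Qed.

Lemma measurable_cylinder B : (forall i, measurable (B i)) ->
  measurable (\bigcap_i (Z i @^-1` B i)).
Proof.
move=> mB; apply: fin_bigcap_measurable => // i _.
by rewrite -[X in measurable X]setTI; exact: measurable_funPT.
Qed.

Lemma cylinder_update B (j : 'I_k) (C : set R) : B j = setT ->
  Z j @^-1` C `&` \bigcap_i (Z i @^-1` B i) =
  \bigcap_i (Z i @^-1` (if i == j then C else B i)).
Proof.
move=> Bj; apply/seteqP; split=> [t [Ct Bt] i _|t Bt].
  by rewrite /=; case: eqP => [->//|_]; exact: Bt.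
split=> [|i _]; first by have := Bt j I; rewrite /= eqxx.
by have := Bt i I; rewrite /=; case: eqP => [->|//]; rewrite Bj.
Qed.

Lemma prob_cylinder_update B (j : 'I_k) (C : set R) :
  (forall i, measurable (B i)) -> B j = setT -> measurable C ->
  P (\bigcap_i (Z i @^-1` (if i == j then C else B i))) =
  (gamma C * P (\bigcap_i (Z i @^-1` B i)))%E.
Proof.
move=> mB Bj mC; have [indep law] := HZ.
rewrite !indep //; last by move=> i; case: eqP.
rewrite (bigD1 j) //= [in RHS](bigD1 j) //= Bj preimage_setT eqxx.
have lawC : P (Z j @^-1` C) = gamma C by exact: law.
rewrite probability_setT mul1e lawC; congr (_ * _)%E.
by apply: eq_bigr => i /negPf ->.
Qed.

(* The cylinder event on the variables not yet summed is what gives, in the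
   induction, the joint law of the partial sum and the next variable. *)
Lemma prob_lincomb_cylinder (j : nat) s B (B0 : set mR) :
  (forall i, measurable (B i)) -> measurable B0 ->
  (forall i : 'I_k, (j <= i)%N -> s i = 0) ->
  (forall i : 'I_k, (i < j)%N -> B i = setT) ->
  P ((fun t => \sum_i s i * Z i t) @^-1` B0 `&` \bigcap_i (Z i @^-1` B i)) =
  (gamma ((fun z : mR => Num.sqrt (\sum_i s i ^+ 2) * z : mR)%R @^-1` B0) *
   P (\bigcap_i (Z i @^-1` B i)))%E.
Proof.
elim: j s B B0 => [|j IH] s B B0 mB mB0 s0 BT.
  have sz i : s i = 0 by exact: s0.
  have -> : \sum_i s i ^+ 2 = 0 by rewrite big1 // => i _; rewrite sz expr0n.
  have -> : (fun t => \sum_i s i * Z i t) = cst 0.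
    by apply/funext => t; rewrite big1 // => i _; rewrite sz mul0r.
  have -> : (fun z : mR => Num.sqrt 0 * z : mR) = cst 0.
    by apply/funext => z; rewrite sqrtr0 mul0r.
  rewrite !preimage_cst; case: ifP => _.
    by rewrite setTI probability_setT mul1e.
  by rewrite set0I !measure0 mul0e.
have [kj|jk] := leqP k j.
  apply: IH => // i ij; last by apply: BT; exact: ltnW.
  by have := leq_trans (ltn_ord i) (leq_trans kj ij); rewrite ltnn.
(* The sum splits into the part [S'] without variable [j], to which the induction hypothesis
   applies, and the single term in variable [j]. *)
pose jj := Ordinal jk; pose s' (i : 'I_k) := if i == jj then 0 else s i.
have s'0 (i : 'I_k) : (j <= i)%N -> s' i = 0.
  rewrite /s'; have [//|ij] := eqVneq i jj => ji; apply: s0.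
  by rewrite ltn_neqAle ji andbT eq_sym.
pose S' t := \sum_i s' i * Z i t; pose r := Num.sqrt (\sum_i s' i ^+ 2).
have SE t : \sum_i s i * Z i t = 1 * S' t + s jj * Z jj t.
  rewrite mul1r (bigD1 jj) //= addrC /S' [X in _ = X + _](bigD1 jj) //=.
  rewrite {1}/s' eqxx mul0r add0r; congr (_ + _).
  by apply: eq_bigr => i /negPf ij; rewrite /s' ij.
have rE : \sum_i s i ^+ 2 = r ^+ 2 + s jj ^+ 2.
  rewrite sqr_sqrtr; last by apply: sumr_ge0 => i _; exact: sqr_ge0.
  rewrite (bigD1 jj) //= addrC [X in _ = X + _](bigD1 jj) //=.
  rewrite {1}/s' eqxx expr0n add0r; congr (_ + _).
  by apply: eq_bigr => i /negPf ij; rewrite /s' ij.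
set E := \bigcap_i _; have mE : measurable E by exact: measurable_cylinder.
have mS' : measurable_fun setT S' by exact: measurable_lincomb.
have mSZ : measurable_fun setT (fun t => (S' t, Z jj t) : mR * mR).
  by apply: measurable_fun_pair; [exact: mS'|exact: (measurable_funPT (Z jj))].
have mr : measurable_fun setT (fun z : mR => r * z : mR).
  exact: measurable_funM.
pose m' := measure_pushforward (mrestr P mE) mSZ.
have PE : P E \is a fin_num by exact: fin_num_measure.
have PE0 : 0 <= fine (P E) by exact: fine_ge0.
pose m1 : {finite_measure set mR -> \bar R} :=
  mscale (NngNum PE0) (distribution gamma (mfun_of mr)).
(* On the event [E], the pair (S', Z_j) has the law of (r z, z') with z, z' independent standard
   normal, weighted by P(E). Uniqueness of the product measure reduces this to rectangles, where the
   condition on Z_j joins the cylinder in the induction hypothesis. *)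
have m'E : forall X, measurable X -> (m1 \x gamma)%E X = m' X.
  apply: product_measure_unique => A C mA mC.
  transitivity (P (S' @^-1` A `&` (Z jj @^-1` C `&` E))).
    by rewrite setIA.
  have Bjj : B jj = setT by exact: BT.
  rewrite cylinder_update // IH //; first last.
  - move=> i ij; have [iE|_] := eqVneq i jj; last exact/BT/ltnW.
    by rewrite iE ltnn in ij.
  - by move=> i; case: eqP.
  rewrite prob_cylinder_update // /m1 /= /mscale /= fineK // muleCA.
  by rewrite [RHS]muleC; congr (_ * _)%E; exact: muleC.
pose X := (fun z : mR * mR => 1 * z.1 + s jj * z.2 : mR) @^-1` B0.
have mh : measurable_fun setT (fun z : mR * mR => 1 * z.1 + s jj * z.2 : mR).
  by apply: measurable_funD; apply: measurable_funM.
have mX : measurable X by rewrite -[X in measurable X]setTI; exact: mh.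
transitivity (m' X).
  by congr (P (_ `&` _)); apply/seteqP; split=> t; rewrite /= SE.
rewrite -m'E // rE -normal_prob_rotation ?sqrtr_ge0 //.
rewrite /product_measure1 /= ge0_integral_mscale //; last first.
  exact: measurable_fun_xsection.
rewrite fineK // muleC; congr (_ * _)%E.
have -> (f : mR -> \bar R) : measurable_fun setT f -> (forall x, 0 <= f x)%E ->
    (\int[distribution gamma (mfun_of mr)]_x f x =
     \int[gamma]_x f (r * x)%R)%E.
- by move=> mf f0; rewrite ge0_integral_distribution.
- apply: eq_integral => x _ /=; congr (normal_prob _ _ _).
  by apply/seteqP; split=> y; rewrite /xsection /= !inE /X /= mul1r.
- exact: measurable_fun_xsection.
- by move=> x; exact: measure_ge0.
Qed.

(** Taking j = k and the full cylinder in [prob_lincomb_cylinder] identifies the law of the whole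
    combination. *)
Lemma ge0_integral_lincomb s (f : mR -> \bar R) :
  measurable_fun setT f -> (forall x, 0 <= f x)%E ->
  (\int[P]_t f (\sum_i s i * Z i t)%R =
   \int[gamma]_z f (Num.sqrt (\sum_i s i ^+ 2) * z)%R)%E.
Proof.
move=> mf f0; set r := Num.sqrt _.
have mr : measurable_fun setT (fun z : mR => r * z : mR).
  exact: measurable_funM.
have mS : measurable_fun setT (fun t => \sum_i s i * Z i t : mR).
  exact: measurable_lincomb.
pose S : {RV P >-> mR} := mfun_of mS.
transitivity (\int[distribution P S]_x f x)%E.
  by rewrite ge0_integral_distribution.
transitivity (\int[distribution gamma (mfun_of mr)]_x f x)%E; last first.
  by rewrite ge0_integral_distribution.
apply: eq_measure_integral => A mA _.
have ET : \bigcap_i (Z i @^-1` (fun=> [set: R]) i) = setT by apply/seteqP; split.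
have := @prob_lincomb_cylinder k s (fun=> setT) A.
rewrite ET setIT probability_setT mule1; apply => //.
by move=> i; rewrite leqNgt ltn_ord.
Qed.

Lemma integral_abs_lincomb s :
  (\int[P]_t (`|\sum_i s i * Z i t|)%:E =
   (2 / Num.sqrt (pi *+ 2) * Num.sqrt (\sum_i s i ^+ 2))%:E)%E.
Proof.
have mabs : measurable_fun setT (fun x : mR => `|x|%:E).
  by apply/measurable_EFinP; exact: normr_measurable.
rewrite (@ge0_integral_lincomb s (fun x => `|x|%:E)) //.
under eq_integral do rewrite normrM ger0_norm ?sqrtr_ge0 // EFinM.
rewrite ge0_integralZl_EFin ?sqrtr_ge0 // integral_abs_normal.
by rewrite -EFinM mulrC.
Qed.

Lemma integral_sqr_lincomb_le s :
  (\int[P]_t ((\sum_i s i * Z i t) ^+ 2)%:E <= (\sum_i s i ^+ 2)%:E)%E.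
Proof.
have s0 : 0 <= \sum_i s i ^+ 2 by apply: sumr_ge0 => i _; exact: sqr_ge0.
have msq : measurable_fun setT (fun x : mR => (x ^+ 2)%:E).
  by apply/measurable_EFinP; exact: measurable_funX.
have sq0 (x : R) : (0 <= (x ^+ 2)%:E)%E by rewrite lee_fin sqr_ge0.
rewrite (@ge0_integral_lincomb s (fun x => (x ^+ 2)%:E)) //.
under eq_integral do rewrite exprMn sqr_sqrtr // EFinM.
rewrite ge0_integralZl_EFin // -[leRHS]mule1.
by rewrite lee_wpmul2l ?lee_fin // integral_sqr_normal_le1.
Qed.

End LinearCombination.

(** * Pointwise lower bound for the quotient, and measurability of quadratic forms *)

Lemma tr_gram_rows (R : realType) p q (M : 'M[R]_(p, q)) :
  \tr (M *m M^T) = \sum_i \sum_j M i j ^+ 2.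
Proof.
apply: eq_bigr => i _; rewrite mxE; apply: eq_bigr => j _.
by rewrite mxE expr2.
Qed.

(** The difference of the two sides is (|x| - c N)^2 / N. For N = 0 the quotient is 0 by convention,
    and x = 0 is then what makes the inequality hold. *)
Lemma double_mul_le_quotient (R : realType) (x N c : R) :
  0 <= N -> (N = 0 -> x = 0) -> 2 * c * `|x| <= x ^+ 2 / N + c ^+ 2 * N.
Proof.
move=> N0 Nx; have [Nz|Nn] := eqVneq N 0.
  by rewrite Nz Nx // normr0 expr0n !mulr0 mul0r addr0.
have Np : 0 < N by rewrite lt_neqAle eq_sym Nn.
rewrite -subr_ge0 -real_normK ?num_real //.
have -> : `|x| ^+ 2 / N + c ^+ 2 * N - 2 * c * `|x| = (`|x| - c * N) ^+ 2 / N.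
  by field.
by rewrite divr_ge0 ?sqr_ge0.
Qed.

(** Trades the quotient for absolute values of linear forms and a squared norm, whose Gaussian
    expectations can be controlled. *)
Lemma gram_quotient_lower_bound (R : realType) p q (K : 'M[R]_(p, q))
    (g : 'cV[R]_q) (c : 'I_p -> R) :
  \sum_l 2 * c l * `|(K *m g) l 0| <=
  (g^T *m (K^T *m K) *m g) 0 0 / (g^T *m g) 0 0 +
  (\sum_l c l ^+ 2) * (g^T *m g) 0 0.
Proof.
have -> : g^T *m (K^T *m K) *m g = (K *m g)^T *m (K *m g).
  by rewrite trmx_mul !mulmxA.
rewrite (mulmx_tr1E (K *m g)) !mulr_suml -big_split /=; apply: ler_sum => l _.
rewrite -expr2; apply: double_mul_le_quotient; first exact: gram_ge0.
move=> g0; have -> : g = 0; last by rewrite mulmx0 mxE.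
by apply: gram_tr_eq0; rewrite [_ *m _]mx11_scalar mxtrace_scalar g0 mul0rn.
Qed.

Lemma measurable_mx_entry (R : realType) n m (i : 'I_n) (j : 'I_m) :
  measurable_fun setT (fun M : borelMx R n m => (M : 'M[R]_(n, m)) i j).
Proof.
apply: (measurability _ (RGenOpens.measurableE R)).
move=> _ [_ [a [b ->] <-]]; rewrite setTI; apply: sub_sigma_algebra.
by apply: open_comp => [M _|]; [exact: coord_continuous|exact: interval_open].
Qed.

Lemma measurable_quad_form (R : realType) (d : measure_display)
    (T : measurableType d) n m (A : 'M[R]_(m * n)) (Q : T -> 'M[R]_(n, m)) :
  (forall i j, measurable_fun setT (fun t => Q t i j)) ->
  measurable_fun setT (fun t => ((vec (Q t))^T *m A *m vec (Q t)) 0 0).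
Proof.
move=> mQ; have mv k : measurable_fun setT (fun t => vec (Q t) k 0).
  case/mxvec_indexP: k => j i.
  by apply: (eq_measurable_fun (fun t => Q t i j)) => // t _; rewrite vecE.
apply: (eq_measurable_fun (fun t => \sum_l (\sum_k vec (Q t) k 0 * A k l) *
    vec (Q t) l 0)) => [t _|].
  rewrite [RHS]mxE; apply: eq_bigr => l _; congr (_ * _); rewrite [RHS]mxE.
  by apply: eq_bigr => k _; rewrite [in RHS]mxE.
apply: measurable_sum => l; apply: measurable_funM => //.
by apply: measurable_sum => k; apply: measurable_funM.
Qed.

(** * Expectation of the rounded value *)

Section GaussianRounding.
Context {R : realType} {d : measure_display} {T : measurableType d}.
Context (P : probability T R) {k : nat} (Z : 'I_k -> {RV P >-> R}).
Hypothesis HZ : standard_normal_family Z.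
Local Notation kappa := (2 / Num.sqrt (pi *+ 2) : R).

Lemma measurable_sqr_norm_gaussian p (L : 'M[R]_(p, k)) :
  measurable_fun setT (fun t => \sum_r (\sum_i L r i * Z i t) ^+ 2).
Proof.
apply: measurable_sum => r; apply: measurable_funX.
exact: measurable_lincomb.
Qed.

Lemma integral_sqr_norm_gaussian_le p (L : 'M[R]_(p, k)) :
  (\int[P]_t (\sum_r (\sum_i L r i * Z i t) ^+ 2)%:E <= (\tr (L *m L^T))%:E)%E.
Proof.
rewrite tr_gram_rows -sumEFin.
under eq_integral do rewrite -sumEFin.
rewrite ge0_integral_sum //; last 2 first.
- move=> r; apply/measurable_EFinP; apply: measurable_funX.
  exact: measurable_lincomb.
- by move=> r t _; rewrite lee_fin sqr_ge0.
by apply: lee_sum => r _; exact: integral_sqr_lincomb_le.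
Qed.

Lemma integral_weighted_abs_gaussian p (M : 'M[R]_(p, k)) (c : 'I_p -> R) :
  (forall l, 0 <= c l) ->
  (\int[P]_t (\sum_l c l * `|\sum_i M l i * Z i t|)%:E =
   (\sum_l c l * (kappa * Num.sqrt (\sum_i M l i ^+ 2)))%:E)%E.
Proof.
move=> c0; rewrite -sumEFin.
have mX l : measurable_fun setT (fun t => (`|\sum_i M l i * Z i t|)%:E).
  apply/measurable_EFinP; apply: measurableT_comp; first exact: normr_measurable.
  exact: measurable_lincomb.
under eq_integral do rewrite -sumEFin.
rewrite ge0_integral_sum //; last 2 first.
- by move=> l; under eq_fun do rewrite EFinM; exact: emeasurable_funM.
- by move=> l t _; rewrite lee_fin mulr_ge0.
apply: eq_bigr => l _; under eq_integral do rewrite EFinM.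
by rewrite ge0_integralZl_EFin // integral_abs_lincomb // EFinM.
Qed.

(* The weights [kappa * sigma_l / m], with [sigma_l] the standard deviation of
   the l-th coordinate of [K g], optimize the resulting quadratic bound. *)
Lemma expectation_gaussian_quotient_bound p q (K : 'M[R]_(p, q))
    (L : 'M[R]_(q, k)) (m : R) (f : T -> R) :
  0 < m -> \tr (L *m L^T) <= m ->
  measurable_fun setT f -> (forall t, 0 <= f t) ->
  {ae P, forall t, let g := L *m \col_i Z i t in
    (g^T *m (K^T *m K) *m g) 0 0 / (g^T *m g) 0 0 <= f t} ->
  ((2 / (pi * m) * \tr ((K *m L) *m (K *m L)^T))%:E <= \int[P]_t (f t)%:E)%E.
Proof.
move=> m0 trL mf f0 Hf; set M := K *m L.
pose sigma l := Num.sqrt (\sum_i M l i ^+ 2).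
have kappa0 : 0 <= kappa by rewrite divr_ge0 ?sqrtr_ge0.
have kappa2 : kappa ^+ 2 = 2 / pi.
  rewrite expr_div_n sqr_sqrtr; last by rewrite mulrn_wge0 ?pi_ge0.
  by move: pi (pi_gt0 R) => x x0; field; rewrite gt_eqF.
pose c l := kappa * sigma l / m; pose C := \sum_l c l ^+ 2.
have c0 l : 0 <= 2 * c l.
  by rewrite mulr_ge0 // divr_ge0 ?mulr_ge0 ?sqrtr_ge0 // ltW.
have C0 : 0 <= C by apply: sumr_ge0 => l _; exact: sqr_ge0.
have trM : \tr (M *m M^T) = \sum_l sigma l ^+ 2.
  rewrite tr_gram_rows; apply: eq_bigr => l _.
  by rewrite sqr_sqrtr // sumr_ge0 // => i _; exact: sqr_ge0.
pose N t := \sum_r (\sum_i L r i * Z i t) ^+ 2.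
have N0 t : 0 <= N t by apply: sumr_ge0 => r _; exact: sqr_ge0.
have mN : measurable_fun setT N by exact: measurable_sqr_norm_gaussian.
have le1 : (\int[P]_t (\sum_l 2 * c l * `|\sum_i M l i * Z i t|)%:E <=
    \int[P]_t (f t + C * N t)%:E)%E.
  apply: ae_ge0_le_integral => //.
  - by move=> t _; rewrite lee_fin sumr_ge0 // => l _; rewrite mulr_ge0.
  - apply/measurable_EFinP; apply: measurable_sum => l.
    apply: measurable_funM => //; apply: measurableT_comp => //.
    exact: measurable_lincomb.
  - by move=> t _; rewrite lee_fin addr_ge0 // mulr_ge0.
  - apply/measurable_EFinP; apply: measurable_funD => //.
    exact: measurable_funM.
  apply: filterS Hf => t /= Hft _; rewrite lee_fin.
  have coord r s (B : 'M[R]_(r, k)) :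
      (B *m \col_i Z i t) s 0 = \sum_i B s i * Z i t.
    by rewrite mxE; apply: eq_bigr => i _; rewrite mxE.
  set g := L *m \col_i Z i t in Hft.
  have NE : (g^T *m g) 0 0 = N t.
    by rewrite mulmx_tr1E; apply: eq_bigr => r _; rewrite coord expr2.
  have XE l : (K *m g) l 0 = \sum_i M l i * Z i t by rewrite mulmxA coord.
  have := gram_quotient_lower_bound K g c; rewrite NE in Hft *.
  rewrite (eq_bigr _ (fun l _ => congr1 (fun x => 2 * c l * `|x|) (XE l))).
  by move=> /le_trans; apply; rewrite lerD2r.
move: le1; rewrite integral_weighted_abs_gaussian //.
under [X in (_ <= X)%E]eq_integral do rewrite EFinD EFinM.
rewrite ge0_integralD //; last 4 first.
- by move=> t _; rewrite lee_fin.
- exact/measurable_EFinP.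
- by move=> t _; rewrite -EFinM lee_fin mulr_ge0.
- by apply: emeasurable_funM => //; exact/measurable_EFinP.
rewrite ge0_integralZl_EFin //; last 2 first.
- by move=> t _; rewrite lee_fin.
- exact/measurable_EFinP.
(* The term C N is moved to the other side with a minus sign, so an upper bound on the second moment
   is the one required. *)
have leN : (C%:E * \int[P]_t (N t)%:E <= (C * m)%:E)%E.
  rewrite EFinM lee_wpmul2l ?lee_fin //.
  by apply: le_trans (integral_sqr_norm_gaussian_le L) _; rewrite lee_fin.
move=> /le_trans/(_ (leeD2l _ leN)).
rewrite -leeBlDr // -EFinB; apply: le_trans; rewrite lee_fin trM.
rewrite le_eqVlt; apply/orP; left; apply/eqP.
transitivity (kappa ^+ 2 / m * \sum_l sigma l ^+ 2).
  by rewrite kappa2; congr (_ * _); rewrite invfM mulrA.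
(* For each l, the chosen weight gives 2 c_l kappa sigma_l - c_l^2 m = kappa^2 sigma_l^2 / m. *)
rewrite /C mulr_suml -sumrB mulr_sumr; apply: eq_bigr => l _.
rewrite /c -/(sigma l); move: kappa (sigma l) => a b.
by field; rewrite gt_eqF.
Qed.

End GaussianRounding.

Theorem proposition5 (R : realType) (d : measure_display)
    (T : measurableType d) (P : probability T R) (n m : nat)
    (m_ge1 : (1 <= m)%N) (m_le_n : (m <= n)%N)
    (A : 'M[R]_(m * n)) (A_psd : psdmx A)
    (Wstar : 'M[R]_(m * n)) (Wstar_opt : sdp_optimal A Wstar)
    (Q : T -> 'M[R]_(n, m)) (HQ : relax_and_project P Wstar Q) :
  ((2 / (pi * m%:R) * frobenius A Wstar)%:E <=
     'E_P[fun t => (((vec (Q t))^T *m A *m vec (Q t)) 0 0)%R])%E.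
Proof.
case: HQ => G [U [D [V [[k [L [Z [HZ LW Gae]]]] Hsvd QE]]]].
have [p [K AE]] := psdmx_factor A_psd.
have trW : \tr Wstar = m%:R.
  case: (Wstar_opt) => /sdp_feasibleP[_ _ W1] _.
  by rewrite -trace_tracemxE W1 mxtrace1.
have -> : frobenius A Wstar = \tr ((K *m L) *m (K *m L)^T).
  rewrite /frobenius (proj1 A_psd) AE -LW trmx_mul -!mulmxA mxtrace_mulC.
  by rewrite -!mulmxA.
(* Borel functions of G have measurable entries; applied to [U] and [V], this makes the rounded
   value a measurable function. *)
have mG (r s : nat) (F : {mfun borelMx R n m >-> borelMx R r s}) i j :
    measurable_fun setT (fun t => (F (G t) : 'M[R]_(r, s)) i j).
  have mF : measurable_fun setT (fun M => (F M : 'M[R]_(r, s)) i j).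
    exact: (measurableT_comp (measurable_mx_entry i j) (measurable_funPT F)).
  exact: (measurableT_comp mF (measurable_funPT G)).
rewrite unlock; apply: (expectation_gaussian_quotient_bound (P := P) HZ) => //.
- by rewrite ltr0n.
- by rewrite LW trW.
- apply: measurable_quad_form => i j.
  apply: (eq_measurable_fun (fun t => \sum_l (U (G t) : 'M[R]_(n, m)) i l *
    (V (G t) : 'M[R]_m) j l)) => [t _|].
    by rewrite QE mxE; apply: eq_bigr => l _; rewrite [in RHS]mxE.
  by apply: measurable_sum => l; apply: measurable_funM; exact: mG.
- by move=> t; exact: (proj2 A_psd).
(* Almost surely vec G = L z with L L^T equal to the optimal solution, so the deterministic bound
   applies outcome by outcome. *)
apply: filterS Gae => t Gt; rewrite -Gt QE -AE.
apply: (polar_rounding_lower_bound m_le_n A_psd _ Gt (Hsvd (G t))).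
by rewrite LW.
Qed.
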